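(* Let $(X,\sigma,\tau)$ be a multipermutation solution of level $2$. The following conditions are equivalent: (1) $(X,\sigma,\tau)$ is distributive; (2) $(X,\sigma,\tau)$ is $2$-reductive; (3) $(X,\sigma,\tau)$ satisfies Condition lri, i.e. $\tau_x=\sigma_x^{-1}$ for all $x\in X$; (4) $\mathrm{Ret}(X,\sigma,\tau)$ is the trivial solution.
   Context: A solution is a triple $(X,\sigma,\tau)$ with $X$ a non-empty set of arbitrary cardinality and $\sigma,\tau\colon X\times X\to X$. Write $\sigma_x=\sigma(x,\cdot)$, $\tau_y=\tau(\cdot,y)$ and $r(x,y)=(\sigma_x(y),\tau_y(x))$. It is required that: (braid relation) $(\mathrm{id}\times r)(r\times \mathrm{id})(\mathrm{id}\times r)=(r\times \mathrm{id})(\mathrm{id}\times r)(r\times \mathrm{id})$ on $X^3$; (non-degenerate) all $\sigma_x$ and $\tau_y$ are bijections of $X$; (involutive) $r^2=\mathrm{id}_{X^2}$. Retraction: define $x\sim y$ iff $\sigma_x=\sigma_y$. It is known that $\sigma,\tau$ induce well-defined operations on $X/\mathord{\sim}$, making it a solution $\mathrm{Ret}(X,\sigma,\tau)$, with $\overline\sigma([x],[y])=[\sigma(x,y)]$ and $\overline\tau([x],[y])=[\tau(x,y)]$. Put $\mathrm{Ret}^0(X,\sigma,\tau)=(X,\sigma,\tau)$ and $\mathrm{Ret}^k(X,\sigma,\tau)=\mathrm{Ret}(\mathrm{Ret}^{k-1}(X,\sigma,\tau))$ for $k\ge 1$. A solution is a multipermutation solution of level $m$ if $m$ is the least non-negative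 integer with $|\mathrm{Ret}^m(X,\sigma,\tau)|=1$. Write $x\circ y=\sigma_x(y)$ and $x\bullet y=\tau_y(x)$. A solution is distributive if $x\circ(y\circ z)=(x\circ y)\circ(x\circ z)$ and $(y\bullet z)\bullet x=(y\bullet x)\bullet(z\bullet x)$ for all $x,y,z\in X$. It is $2$-reductive if $(x\circ y)\circ z=y\circ z$ for all $x,y,z\in X$. A solution is trivial if $\sigma(x,y)=y$ and $\tau(x,y)=x$ for all $x,y$. *)

(* Defs.v *)
From mathcomp Require Import all_boot.
From mathcomp Require Import boolp.

Set Implicit Arguments.
Unset Strict Implicit.
Unset Printing Implicit Defensive.

Local Open Scope quotient_scope.

Section YangBaxterMap.
Variables (X : Type) (sigma tau : X -> X -> X).

(* sigma_x = sigma x, whereas tau_y = tau^~ y acts on the first argument. *)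
Definition yb_map (p : X * X) : X * X := (sigma p.1 p.2, tau p.1 p.2).

Definition r12 (t : X * X * X) : X * X * X := (yb_map t.1, t.2).

Definition r23 (t : X * X * X) : X * X * X :=
  let: (x, y, z) := t in let: (y', z') := yb_map (y, z) in (x, y', z').

Record is_solution : Prop := IsSolution {
  sol_inhabited : inhabited X;
  sol_braid : r23 \o r12 \o r23 =1 r12 \o r23 \o r12;
  sol_bij_sigma : forall x, bijective (sigma x);
  sol_bij_tau : forall y, bijective (tau^~ y);
  sol_involutive : involutive yb_map }.

End YangBaxterMap.

Record solution := Solution {
  sol_carrier :> Type;
  sol_sigma : sol_carrier -> sol_carrier -> sol_carrier;
  sol_tau : sol_carrier -> sol_carrier -> sol_carrier;
  solP : is_solution sol_sigma sol_tau }.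

Section SolutionTheory.
Variables (X : Type).
Implicit Types sigma tau : X -> X -> X.

Lemma is_solution_dual sigma tau : is_solution sigma tau ->
  is_solution (fun x y => tau y x) (fun x y => sigma y x).
Proof.
case=> inh br bs bt iv; split=> // [[[x y] z]|[x y]] /=.
  by have [h1 h2 h3] := br (z, y, x); congr (_, _, _).
by have /= := iv (y, x); rewrite /yb_map /= => -[-> ->].
Qed.

Section Identities.
Variables (sigma tau : X -> X -> X) (S : is_solution sigma tau).

Lemma sol_braid_sigma x y z :
  sigma x (sigma y z) = sigma (sigma x y) (sigma (tau x y) z).
Proof. by have := sol_braid S (x, y, z) => /= -[]. Qed.

Lemma sol_inv_sigma x y : sigma (sigma x y) (tau x y) = x.
Proof. by have := sol_involutive S (x, y) => -[]. Qed.

Lemma sol_inv_tau x y : tau (sigma x y) (tau x y) = y.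
Proof. by have := sol_involutive S (x, y) => -[]. Qed.

Lemma sigma_eq_tau y y' : sigma y = sigma y' -> tau^~ y = tau^~ y'.
Proof.
move=> e; apply/funext => z.
have inj x : injective (sigma x) := bij_inj (sol_bij_sigma S x).
have diagP w : exists2 s, sigma w s = w & tau w s = s.
  have [g _ gK] := sol_bij_sigma S w; exists (g w); first exact: gK.
  by apply: (inj w); rewrite gK -[RHS](sol_inv_sigma w (g w)) gK.
have [s sw ts] := diagP (tau z y).
have [s' sw' ts'] := diagP (tau z y').
have ss : s = s'.
  apply: (inj y); apply: (inj z); rewrite [in RHS]e.
  by rewrite sol_braid_sigma sw (sol_braid_sigma z y') sw' !sol_inv_sigma.
by apply: (bij_inj (sol_bij_tau S s)) => /=; rewrite ts [in RHS]ss ts'.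
Qed.

Lemma sigma_congr x x' y y' : sigma x = sigma x' -> sigma y = sigma y' ->
  sigma (sigma x y) = sigma (sigma x' y').
Proof.
move=> <- e; apply/funext => z.
have et : tau x y = tau x y' := congr1 (@^~ x) (sigma_eq_tau e).
have [g _ gK] := sol_bij_sigma S (tau x y).
by rewrite -(gK z) -sol_braid_sigma e (sol_braid_sigma x y') et.
Qed.

Lemma sigma_inv_congr x g y y' : cancel (sigma x) g -> cancel g (sigma x) ->
  sigma y = sigma y' -> sigma (g y) = sigma (g y').
Proof.
move=> sK gK e; apply/funext => z; apply: (can_inj sK).
rewrite (sol_braid_sigma x (g y)) (sol_braid_sigma x (g y')) !gK e; congr (sigma _ (sigma _ _)).
apply: (bij_inj (sol_bij_sigma S y')).
have h w : sigma w (tau x (g w)) = x by rewrite -{1}(gK w) sol_inv_sigma.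
by rewrite h -e h.
Qed.

End Identities.

Lemma tau_eq_sigma sigma tau (S : is_solution sigma tau) y y' :
  tau^~ y = tau^~ y' -> sigma y = sigma y'.
Proof. exact: (sigma_eq_tau (is_solution_dual S)). Qed.

Lemma tau_congr sigma tau (S : is_solution sigma tau) x x' y y' :
  sigma x = sigma x' -> sigma y = sigma y' ->
  sigma (tau x y) = sigma (tau x' y').
Proof.
move=> /(sigma_eq_tau S) ex /(sigma_eq_tau S) ey; apply: (tau_eq_sigma S).
exact: (sigma_congr (is_solution_dual S) ey ex).
Qed.

Lemma tau_inv_congr sigma tau (S : is_solution sigma tau) x g y y' :
  cancel (tau^~ x) g -> cancel g (tau^~ x) ->
  sigma y = sigma y' -> sigma (g y) = sigma (g y').
Proof.
move=> sK gK /(sigma_eq_tau S) e; apply: (tau_eq_sigma S).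
exact: (sigma_inv_congr (is_solution_dual S) sK gK e).
Qed.

End SolutionTheory.

Section Retraction.
Variable S : solution.

(* {classic S} is S endowed with a choiceType structure. *)
Definition ret_rel : rel {classic S} :=
  fun x y => `[< sol_sigma x = sol_sigma y >].

Lemma ret_rel_refl : reflexive ret_rel.
Proof. by move=> x; apply/asboolP. Qed.

Lemma ret_rel_sym : symmetric ret_rel.
Proof. by move=> x y; apply/asboolP/asboolP => ->. Qed.

Lemma ret_rel_trans : transitive ret_rel.
Proof. by move=> y x z /asboolP xy /asboolP yz; apply/asboolP; rewrite xy. Qed.

Canonical ret_equiv : equiv_rel {classic S} :=
  EquivRel ret_rel ret_rel_refl ret_rel_sym ret_rel_trans.

Definition ret_carrier := {eq_quot ret_equiv}.

Definition ret_class (x : S) : ret_carrier := \pi_ret_carrier x.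

(* Representatives are used to define the operations; independence of the
   choice is ret_sigmaE and ret_tauE. *)
Definition ret_sigma (a b : ret_carrier) : ret_carrier :=
  ret_class (sol_sigma (repr a : S) (repr b : S)).

Definition ret_tau (a b : ret_carrier) : ret_carrier :=
  ret_class (sol_tau (repr a : S) (repr b : S)).

Lemma ret_classP (x y : S) :
  ret_class x = ret_class y <-> sol_sigma x = sol_sigma y.
Proof.
split=> [/eqmodP/asboolP //|e].
by apply/eqmodP/asboolP.
Qed.

Lemma ret_classK (a : ret_carrier) : ret_class (repr a) = a.
Proof. exact: reprK. Qed.

Lemma ret_classW (P : ret_carrier -> Prop) :
  (forall x : S, P (ret_class x)) -> forall a, P a.
Proof. by move=> h a; rewrite -(ret_classK a). Qed.

Lemma sigma_repr (x : S) :
  sol_sigma (repr (ret_class x) : S) = sol_sigma x.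
Proof. by apply/ret_classP; rewrite ret_classK. Qed.

Lemma ret_sigmaE (x y : S) :
  ret_sigma (ret_class x) (ret_class y) = ret_class (sol_sigma x y).
Proof.
by apply/ret_classP; apply: (sigma_congr (solP S)); apply: sigma_repr.
Qed.

Lemma ret_tauE (x y : S) :
  ret_tau (ret_class x) (ret_class y) = ret_class (sol_tau x y).
Proof.
by apply/ret_classP; apply: (tau_congr (solP S)); apply: sigma_repr.
Qed.

Lemma ret_is_solution : is_solution ret_sigma ret_tau.
Proof.
have [[x0] br bs bt iv] := solP S; split.
- exact: (inhabits (ret_class x0)).
- case=> [[a b] c].
  elim/ret_classW: a => x; elim/ret_classW: b => y; elim/ret_classW: c => z.
  rewrite /r12 /r23 /yb_map /= !(ret_sigmaE, ret_tauE).
  by have [h1 h2 h3] := br (x, y, z); congr (ret_class _, ret_class _, ret_class _).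
- elim/ret_classW => x; have [g sK gK] := bs x.
  exists (fun b => ret_class (g (repr b))) => b; elim/ret_classW: b => y.
    rewrite ret_sigmaE -{2}(sK y).
    apply/ret_classP; apply: (sigma_inv_congr (solP S) sK gK).
    exact: sigma_repr.
  by rewrite ret_sigmaE gK ret_classK.
- elim/ret_classW => x; have [g sK gK] := bt x.
  exists (fun b => ret_class (g (repr b))) => b; elim/ret_classW: b => y /=.
    rewrite ret_tauE -{2}(sK y).
    apply/ret_classP; apply: (tau_inv_congr (solP S) sK gK).
    exact: sigma_repr.
  by rewrite ret_tauE gK ret_classK.
case=> a b; elim/ret_classW: a => x; elim/ret_classW: b => y.
rewrite /yb_map /= !(ret_sigmaE, ret_tauE).
by have := iv (x, y); rewrite /yb_map /= => -[-> ->].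
Qed.

Definition Ret : solution := Solution ret_is_solution.

End Retraction.

Definition singleton_type (T : Type) : Prop := exists x : T, forall y : T, y = x.

Definition multipermutation_level (m : nat) (S : solution) : Prop :=
  singleton_type (iter m Ret S) /\
  forall k, k < m -> ~ singleton_type (iter k Ret S).

Section Properties.
Variable S : solution.
Local Notation "x ∘ y" := (sol_sigma x y) (at level 40).
Local Notation "x • y" := (sol_tau x y) (at level 40).

Definition distributive_solution : Prop :=
  (forall x y z : S, x ∘ (y ∘ z) = (x ∘ y) ∘ (x ∘ z)) /\
  (forall x y z : S, (y • z) • x = (y • x) • (z • x)).

Definition two_reductive : Prop :=
  forall x y z : S, (x ∘ y) ∘ z = y ∘ z.

Definition condition_lri : Prop :=
  forall x : S, cancel (sol_sigma x) (fun y => y • x) /\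
                cancel (fun y => y • x) (sol_sigma x).

Definition trivial_solution : Prop :=
  forall x y : S, sol_sigma x y = y /\ sol_tau x y = x.

End Properties.

(* Main.v *)
Require Import Defs.
From mathcomp Require Import all_boot.
From mathcomp Require Import boolp.

(** Level [2] means that the permutation [sigma (sigma x y)] depends on [y]
    alone (lemma [level2_sigma_sigma]), so that [Ret S] is a permutation
    solution given by one bijection of the classes.  All four conditions say
    that this bijection is the identity, that is, [sigma (sigma x y) = sigma y].
    For the triviality of [Ret S] and for 2-reductivity this is immediate.

    Left distributivity reads [sigma_x sigma_y = sigma_(sigma_x y) sigma_x];
    on the diagonal [x = y] one may cancel and obtain
    [sigma_(sigma_y y) = sigma_y], and independence of [x] extends this to all
    [sigma_(sigma_x y)].  Involutivity reads [sigma_(sigma_x y) (tau_y x) = x].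
    If [S] is 2-reductive, this says [sigma_y (tau_y x) = x], which is lri;
    if conversely [tau_y] is the inverse of [sigma_y], it says that
    [sigma_(sigma_x y)] and [sigma_y] agree at the point [tau_y x], and since
    neither permutation depends on [x] and these points exhaust [S], they are
    equal.

    If [Ret S] is trivial, then [sigma_(tau_y x) = sigma_x], and with this the
    braid relation becomes left distributivity ([sigma_left_distributive]);
    right distributivity is the same statement about the dual solution. *)

(** Equality of all left translations of [Ret S], read on representatives. *)
Lemma level2_sigma_sigma {S : solution} : multipermutation_level 2 S ->
  forall x x' y : S,
    sol_sigma (sol_sigma x y) = sol_sigma (sol_sigma x' y).
Proof.
case=> -[c /= cP] _ x x' y.
have e : ret_class (ret_class x : Ret S) = ret_class (ret_class x' : Ret S).
  by rewrite (cP (ret_class _)) [RHS]cP.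
move/ret_classP: e => /= e.
by apply/ret_classP; rewrite -!ret_sigmaE e.
Qed.

(** The braid relation contains the identity
    [sigma_x sigma_y = sigma_(sigma_x y) sigma_(tau_y x)], in which the
    hypothesis turns the last factor into [sigma_x].  Stated for bare
    operations so that it also applies to the dual solution. *)
Lemma sigma_left_distributive {X : Type} {sigma tau : X -> X -> X} :
    is_solution sigma tau ->
    (forall x y, sigma (tau x y) = sigma x) ->
  forall x y z, sigma x (sigma y z) = sigma (sigma x y) (sigma x z).
Proof. by move=> S st x y z; rewrite (sol_braid_sigma S) st. Qed.

Lemma distributive_two_reductive (S : solution) :
  multipermutation_level 2 S -> distributive_solution S -> two_reductive S.
Proof.
move=> hS [dist _] x y z; rewrite (level2_sigma_sigma hS x y).
(* Distributivity on the diagonal only reaches arguments of the form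
   [sigma_y w]; surjectivity of [sigma_y] provides [z] in this form. *)
have [g _ gK] := sol_bij_sigma (solP S) y.
by rewrite -(gK z) -dist.
Qed.

Lemma two_reductive_lri (S : solution) : two_reductive S -> condition_lri S.
Proof.
move=> red y.
have tauK : cancel (fun x => sol_tau x y) (sol_sigma y).
  by move=> x; rewrite -(red x) (sol_inv_sigma (solP S)).
split=> //; exact/(bij_can_sym (sol_bij_sigma (solP S) y)).
Qed.

Lemma lri_trivial_Ret (S : solution) :
  multipermutation_level 2 S -> condition_lri S -> trivial_solution (Ret S).
Proof.
move=> hS lri.
have sigma_sigma (x y : S) : sol_sigma (sol_sigma x y) = sol_sigma y.
  apply/funext => z; have [sK _] := lri y.
  (* [z] is [tau_y] of [sigma_y z], where involutivity can be applied. *)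
  rewrite (level2_sigma_sigma hS x (sol_sigma y z)) -{2}(sK z).
  exact: (sol_inv_sigma (solP S)).
elim/ret_classW=> x; elim/ret_classW=> y; rewrite /= ret_sigmaE ret_tauE.
split; apply/ret_classP; first exact: sigma_sigma.
have [_ tK] := lri y.
by rewrite -(sigma_sigma y) tK.
Qed.

Lemma trivial_Ret_distributive (S : solution) :
  trivial_solution (Ret S) -> distributive_solution S.
Proof.
move=> triv; have solS := solP S.
have sigma_sigma (x y : S) : sol_sigma (sol_sigma x y) = sol_sigma y.
  apply/ret_classP; rewrite -ret_sigmaE.
  by have [] := triv (ret_class x) (ret_class y).
have sigma_tau (x y : S) : sol_sigma (sol_tau x y) = sol_sigma x.
  apply/ret_classP; rewrite -ret_tauE.
  by have [] := triv (ret_class x) (ret_class y).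
split; first exact: (sigma_left_distributive solS).
(* In the dual solution [tau] plays the role of [sigma]. *)
move=> x y z; apply: (sigma_left_distributive (is_solution_dual solS)).
by move=> u v; apply: (sigma_eq_tau solS).
Qed.

Theorem theorem7p7 (S : solution) (hS : multipermutation_level 2 S) :
  [<-> distributive_solution S;
       two_reductive S;
       condition_lri S;
       trivial_solution (Ret S)].
Proof.
tfae.
- exact: distributive_two_reductive.
- exact: two_reductive_lri.
- exact: lri_trivial_Ret.
- exact: trivial_Ret_distributive.
Qed.
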